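(* Let $\mathcal{S}\subseteq\mathbb{R}^n$ be a finite set of test vectors each of Euclidean norm at most $1$, and let $\mathsf{p}$ be a probability distribution on $\mathbb{R}^n$ supported on vectors of Euclidean norm at most $1$. For vectors $v_1,\dots,v_T$ sampled i.i.d. from $\mathsf{p}$ and revealed one at a time, there is an online algorithm choosing signs $\chi_t\in\{\pm1\}$ that, with high probability, maintains the discrepancy vector $d_t=\sum_{\tau=1}^t\chi_\tau v_\tau$ satisfying $$\max_{z\in\mathcal{S}} |d_t^\top z| = O\big((\log|\mathcal{S}| + \log T)\cdot \log^3(nT)\big)\quad\text{for every } t\in[T].$$
   Context: The algorithm is online: $\chi_t$ is chosen irrevocably upon the arrival of $v_t$, using only $v_1,\dots,v_t$, earlier choices, knowledge of $\mathsf{p}$ and $\mathcal{S}$, and possibly internal randomness. ''With high probability'' refers to the randomness of inputs and algorithm; $O(\cdot)$ hides a universal constant. *)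

(* Defs.v *)
From HB Require Import structures.
From mathcomp Require Import all_boot all_order all_algebra finmap.
From mathcomp Require Import all_classical all_reals all_analysis.
Set Implicit Arguments.
Unset Strict Implicit.
Unset Printing Implicit Defensive.
Import Order.TTheory GRing.Theory Num.Theory.
Import numFieldNormedType.Exports.
Local Open Scope classical_set_scope.
Local Open Scope ring_scope.

(* R^n is [n.-tuple R]: the library equips it with the product sigma-algebra of
   the Borel sigma-algebra of R, i.e. with the Borel sigma-algebra of R^n. *)

Definition dotp (R : realType) (n : nat) (x y : n.-tuple R) : R :=
  \sum_(i < n) tnth x i * tnth y i.

Definition enorm (R : realType) (n : nat) (x : n.-tuple R) : R :=
  Num.sqrt (dotp x x).

Section iid.
Context {d : measure_display} {X : measurableType d} {R : realType}.

Definition tcons (T : nat) (x : X * T.-tuple X) : T.+1.-tuple X :=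
  [tuple of x.1 :: x.2].

Lemma measurable_tcons (T : nat) : measurable_fun setT (@tcons T).
Proof. exact: measurable_cons. Qed.

HB.instance Definition _ (T : nat) :=
  isMeasurableFun.Build _ _ _ _ (@tcons T) (@measurable_tcons T).

(* The law of T independent samples from p, i.e. the T-fold product measure;
   see [iid_law_box]. *)
Fixpoint iid_law (p : probability X R) (T : nat) : probability (T.-tuple X) R :=
  match T return probability (T.-tuple X) R with
  | 0 => \d_[tuple]
  | T'.+1 => distribution (p \x iid_law p T')%E (@tcons T')
  end.

Lemma iid_law_box (p : probability X R) (T : nat) (A : 'I_T -> set X) :
  (forall i, measurable (A i)) ->
  (iid_law p T [set v | forall i, A i (tnth v i)] = \prod_(i < T) p (A i))%E.
Proof.
elim: T A => [|T IH] A mA /=.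
  by rewrite big_ord0 diracE mem_set// => -[].
rewrite big_ord_recl -IH; last by move=> i; exact: mA.
have mB : measurable
    [set v : T.-tuple X | forall i, A (lift ord0 i) (tnth v i)].
  rewrite (_ : mkset _ =
      \big[setI/setT]_(i < T) ((fun v => tnth v i) @^-1` A (lift ord0 i))).
    apply: bigsetI_measurable => i _; rewrite -[X in measurable X]setTI.
    exact: measurable_tnth.
  by apply/seteqP; split => v /=; rewrite -bigcap_seq => h i //=;
     apply: h => //=; rewrite mem_index_enum.
rewrite -product_measure1E// /distribution /pushforward /=.
congr (_ _); apply/seteqP; split => -[x v] /=.
  move=> h; split => /=; first exact: (h ord0).
  by move=> i; have := h (lift ord0 i); rewrite tnthS.
move=> [/= hx hv] i; case: (unliftP ord0 i) => [j ->|->] //.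
by rewrite tnthS.
Qed.

End iid.

(* A randomized online algorithm for vectors in R^n. All internal randomness is
   a single seed drawn in advance. The sign of the latest vector is a function of
   the seed and of the list of the vectors revealed so far, the latest included
   ([true] stands for +1, [false] for -1); the earlier choices are themselves
   functions of these data. *)
Record online_algorithm (R : realType) (n : nat) := OnlineAlgorithm {
  seed_display : measure_display ;
  seed : measurableType seed_display ;
  seed_law : probability seed R ;
  next_sign : seed -> seq (n.-tuple R) -> bool ;
  measurable_next_sign : forall k : nat, measurable_fun setT
    (fun x : seed * k.-tuple (n.-tuple R) => next_sign x.1 x.2)
}.

(* Signs and partial sums are indexed from 0: [sign_at r v t] and
   [discrepancy r v t] are the sign of the vector with index t and the signed
   sum of the vectors with indices 0, ..., t. *)
Definition sign_at (R : realType) (n T : nat) (A : online_algorithm R n)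
    (r : seed A) (v : T.-tuple (n.-tuple R)) (t : 'I_T) : R :=
  if next_sign r (take t.+1 v) then 1 else -1.

Definition discrepancy (R : realType) (n T : nat) (A : online_algorithm R n)
    (r : seed A) (v : T.-tuple (n.-tuple R)) (t : 'I_T) : n.-tuple R :=
  [tuple \sum_(tau < T | (tau <= t)%N) sign_at r v tau * tnth (tnth v tau) i
  | i < n].

(* The seed is independent of the input. *)
Definition run_law (R : realType) (n : nat) (p : probability (n.-tuple R) R)
    (T : nat) (A : online_algorithm R n) :
    probability (seed A * T.-tuple (n.-tuple R))%type R :=
  (seed_law A \x iid_law p T)%E.

(* s stands for the number of test vectors. As [ln 0 = 0], the rate vanishes
   when n = 0 or T = 0; otherwise, for s > 0, it vanishes exactly when T = 1 and
   either s = 1 or n = 1. *)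
Definition disc_rate (R : realType) (n T s : nat) : R :=
  (ln s%:R + ln T%:R) * ln (n * T)%N%:R ^+ 3.

(* Main.v *)
Require Import Defs.
From HB Require Import structures.
From mathcomp Require Import all_boot all_order all_algebra finmap.
From mathcomp Require Import all_classical all_reals all_analysis.
From mathcomp Require Import measurable_realfun ring lra zify.
Import Order.TTheory GRing.Theory Num.Theory.
Import numFieldNormedType.Exports.
Local Open Scope classical_set_scope.
Local Open Scope ring_scope.

(* The algorithm is the self-balancing walk of Alweiss, Liu and Sawhney: with
   current sum w, the vector v gets sign +1 with probability 1/2 - <w,v>/(2b), so
   that w drifts towards 0 along v. For u of norm at most 1/4, one step maps the
   expectation of exp(<w,u> - 2b|u|^2) to at most exp(<w,u'> - 2b|u'|^2), where
   u' = u - (<v,u>/b) v, as long as |<w,v>| <= b. Starting from w = 0 this bounds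
   the exponential moments of w, hence the probability that |<w,v>| > b for an
   arriving v or |<w,z>| > b for a test vector z, by a union bound: it is at most
   2T(1+|S|) exp(-b/8), for every fixed sequence of arrivals. It remains to take
   b = 8(2 + ln |S| + ln T + c ln(nT)) and to integrate over the arrivals. *)

(** * Euclidean geometry of tuples *)

Section inner_product.
Context {R : realType} {n : nat}.
Implicit Types (u v w z : n.-tuple R) (a : R).

Definition axpy w a v : n.-tuple R := [tuple tnth w i + a * tnth v i | i < n].

Definition zerov : n.-tuple R := [tuple 0 | i < n].

Lemma dotpC u v : dotp u v = dotp v u.
Proof. by apply: eq_bigr => i _; rewrite mulrC. Qed.

Lemma dotp_axpyl w a v u : dotp (axpy w a v) u = dotp w u + a * dotp v u.
Proof.
rewrite /dotp big_distrr/= -big_split/=; apply: eq_bigr => i _.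
by rewrite tnth_mktuple mulrDl mulrA.
Qed.

Lemma dotp_axpyr w a v u : dotp u (axpy w a v) = dotp u w + a * dotp u v.
Proof. by rewrite dotpC dotp_axpyl !(dotpC u). Qed.

Lemma dotp0v u : dotp zerov u = 0.
Proof. by rewrite /dotp big1// => i _; rewrite tnth_mktuple mul0r. Qed.

Lemma dotpv0 u : dotp u zerov = 0.
Proof. by rewrite dotpC dotp0v. Qed.

Lemma dotp_ge0 u : 0 <= dotp u u.
Proof. by apply: sumr_ge0 => i _; rewrite -expr2 sqr_ge0. Qed.

Lemma enorm_le1 u : (enorm u <= 1) = (dotp u u <= 1).
Proof. by rewrite /enorm -{1}[1]sqrtr1 ler_sqrt. Qed.

(** Expanding |v + 4u|^2 >= 0 and |v - 4u|^2 >= 0 gives 8|<v,u>| <= |v|^2 + 16|u|^2 <= 2. The value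
    1/4 lies within the range 1/2 allowed by [two_point_mgf]. *)
Lemma normr_dotp_le u v : dotp v v <= 1 -> dotp u u <= 16^-1 ->
  `|dotp v u| <= 4^-1.
Proof.
move=> v1 u1.
have := dotp_ge0 (axpy v 4 u); have := dotp_ge0 (axpy v (- 4) u).
rewrite !dotp_axpyl !dotp_axpyr (dotpC u v) => h1 h2.
by rewrite ler_norml; apply/andP; split; lra.
Qed.

End inner_product.

(** * Exponential moments across one random sign *)

Section one_step.
Context {R : realType} {n : nat}.
Implicit Types (x p : R) (u v w z : n.-tuple R).

(** From 1 - x <= exp(-x) one gets exp(x)(1 - x) <= 1, while (1 + x + 2x^2)(1 - x) = 1 + x^2(1 - 2x)
    >= 1 on this range. *)
Lemma expR_le_quadratic x : x <= 2^-1 -> expR x <= 1 + x + 2 * x ^+ 2.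
Proof.
move=> x2.
have h : 1 - x <= expR (- x) by rewrite expR_ge1Dx.
have e0 : 0 < expR x := expR_gt0 x.
have : expR x * (1 - x) <= 1.
  by apply: le_trans (ler_wpM2l (ltW e0) h) _; rewrite -expRD subrr expR0.
nra.
Qed.

(** Averaging the quadratic bounds at x and -x leaves 1 + (2p - 1)x + 2x^2; then 1 + y <= exp(y). *)
Lemma two_point_mgf p x : 0 <= p <= 1 -> `|x| <= 2^-1 ->
  p * expR x + (1 - p) * expR (- x) <= expR ((2 * p - 1) * x + 2 * x ^+ 2).
Proof.
rewrite ler_norml => /andP[p0 p1] /andP[x1 x2].
have h1 := expR_le_quadratic x x2.
have h2 : expR (- x) <= 1 + - x + 2 * (- x) ^+ 2.
  by apply: expR_le_quadratic; lra.
apply: le_trans (expR_ge1Dx _).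
have := ler_wpM2l p0 h1.
have p1' : 0 <= 1 - p by lra.
have := ler_wpM2l p1' h2.
lra.
Qed.

(** The constant b/8 normalizes the weight: for b > 0 it is at most exp(-b/8) at w = 0 and, by
    [tilt_large], at least 1 once a probed inner product exceeds b. *)
Definition tilt (b : R) w u : R :=
  expR (dotp w u - 2 * b * dotp u u - b / 8).

(** The matrix I - vv^T/b applied to u. It is symmetric and also sends w to its mean after one step,
    so the mean of <w,u> after the step is <w, shrink b v u>. *)
Definition shrink (b : R) v u := axpy u (- (dotp v u / b)) v.

Definition plus_prob (b : R) w v : R := 2^-1 - dotp w v / (2 * b).

Lemma plus_prob_itv b w v : 0 < b -> `|dotp w v| <= b ->
  0 <= plus_prob b w v <= 1.
Proof.
rewrite /plus_prob ler_norml => b0 /andP[h1 h2].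
have -> : dotp w v / (2 * b) = dotp w v / b * 2^-1 by rewrite invfM; ring.
have : -1 <= dotp w v / b by rewrite ler_pdivlMr// mulN1r.
have : dotp w v / b <= 1 by rewrite ler_pdivrMr// mul1r.
by move=> h3 h4; apply/andP; split; lra.
Qed.

(** With a = <v,u>, the left side is b|u|^2 - 2a^2 + a^2|v|^2/b, and |v|^2/b <= 1 gives back at most
    one a^2. *)
Lemma shrink_dotp b v u : 1 <= b -> dotp v v <= 1 ->
  b * dotp (shrink b v u) (shrink b v u) <= b * dotp u u - dotp v u ^+ 2.
Proof.
move=> b1 v1; have b0 : b != 0 by lra.
rewrite !dotp_axpyl !dotp_axpyr (dotpC u v); set a := dotp v u.
have -> : b * (dotp u u + - (a / b) * a + - (a / b) * (a + - (a / b) * dotp v v))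
  = b * dotp u u - a ^+ 2 - a ^+ 2 * (1 - dotp v v / b) by field.
rewrite gerBl mulr_ge0 ?sqr_ge0// subr_ge0 ler_pdivrMr ?mul1r; lra.
Qed.

Lemma shrink_short b v u (r : R) : 1 <= b -> dotp v v <= 1 -> dotp u u <= r ->
  dotp (shrink b v u) (shrink b v u) <= r.
Proof.
move=> b1 v1; apply: le_trans; have b0 : 0 < b by lra.
rewrite -(ler_pM2l b0); apply: le_trans (shrink_dotp b v u b1 v1) _.
by rewrite gerBl sqr_ge0.
Qed.

(* The drift towards 0 is absorbed by [shrink], and the variance term by the
   resulting decrease of the squared length of [u]. *)
Lemma tilt_step b w v u : 1 <= b -> dotp v v <= 1 -> dotp u u <= 16^-1 ->
  `|dotp w v| <= b ->
  plus_prob b w v * tilt b (axpy w 1 v) u +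
  (1 - plus_prob b w v) * tilt b (axpy w (-1) v) u <= tilt b w (shrink b v u).
Proof.
move=> b1 v1 u1 wv; have b0 : 0 < b by lra.
have a4 := normr_dotp_le u v v1 u1.
have m := two_point_mgf (plus_prob b w v) (dotp v u) (plus_prob_itv b w v b0 wv) _.
have {}m := m (le_trans a4 _).
rewrite /tilt !(dotp_axpyl w) mul1r mulN1r.
set k := 2 * b * dotp u u + b / 8.
have -> : dotp w u + dotp v u - 2 * b * dotp u u - b / 8 =
  dotp v u + (dotp w u - k) by rewrite /k; ring.
have -> : dotp w u - dotp v u - 2 * b * dotp u u - b / 8 =
  - dotp v u + (dotp w u - k) by rewrite /k; ring.
rewrite !(expRD _ (dotp w u - k)) !mulrA -mulrDl.
apply: le_trans (ler_wpM2r (expR_ge0 _) (m _)) _; first by lra.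
rewrite -expRD ler_expR /k /plus_prob.
have := shrink_dotp b v u b1 v1; set q := dotp (shrink b v u) _.
rewrite dotp_axpyr.
have -> : (2 * (2^-1 - dotp w v / (2 * b)) - 1) * dotp v u =
  - (dotp v u / b) * dotp w v by field; lra.
lra.
Qed.

(** For the probe u = (s/4)z, <w,u> > b/4 pays for 2b|u|^2 <= b/8 and for the constant b/8. The
    scale 1/4 maximizes t - 2t^2. *)
Lemma tilt_large b w z (s : R) : 0 < b -> dotp z z <= 1 -> s ^+ 2 = 1 ->
  b < s * dotp w z -> 1 <= tilt b w (axpy zerov (s / 4) z).
Proof.
move=> b0 z1 s1 wz; rewrite /tilt -{1}(@expR0 R) ler_expR.
set q := axpy _ _ _.
have -> : dotp q q = s ^+ 2 * dotp z z / 16.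
  by rewrite dotp_axpyl dotp0v dotp_axpyr dotpv0; field.
rewrite dotp_axpyr dotpv0 s1; nra.
Qed.

End one_step.

(** * Potentials: sums of exponential weights over lists of probes *)

Section potential.
Context {R : realType} {n : nat} (b : R).
Implicit Types (U Z : seq (n.-tuple R)) (u v w z : n.-tuple R).

Definition pot U w : R := \sum_(u <- U) tilt b w u.

Definition short U := forall u, u \in U -> dotp u u <= 16^-1.

(** Both signs occur, so that one-sided exponential weights control |<w,z>|. *)
Definition probes Z : seq (n.-tuple R) :=
  [seq axpy zerov (1 / 4) z | z <- Z] ++ [seq axpy zerov (-1 / 4) z | z <- Z].

Lemma pot_ge0 U w : 0 <= pot U w.
Proof. by apply: sumr_ge0 => u _; exact: expR_ge0. Qed.

Lemma pot_cat U1 U2 w : pot (U1 ++ U2) w = pot U1 w + pot U2 w.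
Proof. exact: big_cat. Qed.

Lemma pot0_le U : 0 <= b -> pot U zerov <= (size U)%:R * expR (- (b / 8)).
Proof.
move=> b0; rewrite /pot -sum1_size natr_sum big_distrl/=.
apply: ler_sum => u _; rewrite mul1r ler_expR dotp0v.
have := mulr_ge0 b0 (dotp_ge0 u); lra.
Qed.

Lemma size_probes Z : size (probes Z) = (2 * size Z)%N.
Proof. by rewrite size_cat !size_map mul2n addnn. Qed.

Lemma short_probes Z : (forall z, z \in Z -> dotp z z <= 1) -> short (probes Z).
Proof.
move=> Z1 u; rewrite mem_cat => /orP[] /mapP[z zZ ->];
  rewrite dotp_axpyl dotp0v dotp_axpyr dotpv0; have := Z1 z zZ; lra.
Qed.

Lemma short_cat U1 U2 : short U1 -> short U2 -> short (U1 ++ U2).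
Proof. by move=> h1 h2 u; rewrite mem_cat => /orP[/h1|/h2]. Qed.

Lemma short_shrink v U : 1 <= b -> dotp v v <= 1 -> short U ->
  short [seq shrink b v u | u <- U].
Proof.
by move=> b1 v1 hU _ /mapP[u uU ->]; apply: shrink_short => //; exact: hU.
Qed.

(** The Markov inequality of the argument: the potential dominates the indicator of a violated
    bound, since the violating z, taken with the right sign, alone contributes at least 1. *)
Lemma pot_probes_ge1 Z w : 0 < b -> (forall z, z \in Z -> dotp z z <= 1) ->
  ~~ all (fun z => `|dotp w z| <= b) Z -> 1 <= pot (probes Z) w.
Proof.
move=> b0 Z1 /allPn[z zZ]; rewrite -ltNge lter_normr => wz.
have tilt_ge0 u : 0 <= tilt b w u by exact: expR_ge0.
have [s [s1 sz szZ]] : exists s : R, [/\ s ^+ 2 = 1, b < s * dotp w z &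
    axpy zerov (s / 4) z \in probes Z].
  have [wz0|wz0] := orP wz.
    exists 1; rewrite expr1n mul1r mem_cat; split => //.
    by rewrite map_f.
  exists (-1); rewrite sqrrN expr1n mulN1r mem_cat; split => //.
  by rewrite map_f ?orbT.
apply: le_trans (tilt_large b w z s b0 (Z1 z zZ) s1 sz) _.
by rewrite /pot (big_rem _ szZ)/= lerDl sumr_ge0.
Qed.

Lemma pot_step U w v : 1 <= b -> dotp v v <= 1 -> short U -> `|dotp w v| <= b ->
  plus_prob b w v * pot U (axpy w 1 v) +
  (1 - plus_prob b w v) * pot U (axpy w (-1) v) <=
  pot [seq shrink b v u | u <- U] w.
Proof.
move=> b1 v1 hU wv; rewrite /pot big_map !big_distrr/= -big_split/=.
by rewrite !big_seq; apply: ler_sum => u uU; apply: tilt_step => //; exact: hU.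
Qed.

End potential.

(** * The walk, its good event and the probes controlling it *)

Section walk.
Context {R : realType} {n : nat} (b : R) (Z : seq (n.-tuple R)).
Implicit Types (w : n.-tuple R) (u : nat -> R) (v : nat -> n.-tuple R).

Definition plus w (x : R) (y : n.-tuple R) : bool := x <= plus_prob b w y.

Definition move w (x : R) (y : n.-tuple R) : n.-tuple R :=
  axpy w (if plus w x y then 1 else -1) y.

(** The recursion peels off the first step and shifts both sequences, matching the way [iid_law]
    separates its first sample. *)
Fixpoint walk (k : nat) w u v : n.-tuple R :=
  if k is k'.+1 then walk k' (move w (u 0%N) (v 0%N)) (u \o succn) (v \o succn)
  else w.

(** The arriving vector is tested before the move, which makes [plus_prob] a genuine probability;
    the vectors of Z are tested after it. *)
Fixpoint good (k : nat) w u v : bool :=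
  if k is k'.+1 then
    [&& `|dotp w (v 0%N)| <= b,
        all (fun z => `|dotp (move w (u 0%N) (v 0%N)) z| <= b) Z
      & good k' (move w (u 0%N) (v 0%N)) (u \o succn) (v \o succn)]
  else true.

(** Probes for later tests are pulled back to the starting time by one [shrink] per intervening
    move. Those of [v 0] stay as they are, since that test precedes the move. *)
Fixpoint all_probes (k : nat) v : seq (n.-tuple R) :=
  if k is k'.+1 then
    probes [:: v 0%N] ++
    [seq shrink b (v 0%N) y | y <- probes Z ++ all_probes k' (v \o succn)]
  else [::].

Lemma eq_walk k w u u' v v' : (forall i, (i < k)%N -> u i = u' i) ->
  (forall i, (i < k)%N -> v i = v' i) -> walk k w u v = walk k w u' v'.
Proof.
elim: k w u u' v v' => //= k IH w u u' v v' hu hv.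
rewrite hu// hv//; apply: IH => i ik /=; [exact: hu|exact: hv].
Qed.

(** Unrolls the front recursion into a signed sum whose j-th sign depends on the walk at time j, the
    shape needed for [discrepancy]. *)
Lemma tnth_walk k w u v i : tnth (walk k w u v) i =
  tnth w i + \sum_(j < k)
    (if plus (walk j w u v) (u j) (v j) then 1 else -1) * tnth (v j) i.
Proof.
elim: k w u v => [|k IH] w u v /=; first by rewrite big_ord0 addr0.
by rewrite IH big_ord_recl/= tnth_mktuple addrA.
Qed.

Lemma good_walk k w u v : good k w u v ->
  forall t z, (t < k)%N -> z \in Z -> `|dotp (walk t.+1 w u v) z| <= b.
Proof.
elim: k w u v => //= k IH w u v /and3P[_ /allP h1 h2] [|t] z tk zZ.
  exact: h1.
exact: IH h2 t z tk zZ.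
Qed.

Lemma size_all_probes k v : size (all_probes k v) = (2 * (k * (1 + size Z)))%N.
Proof.
elim: k v => // k IH v /=; rewrite size_map size_cat size_probes IH; lia.
Qed.

Lemma short_all_probes k v : 1 <= b ->
  (forall z, z \in Z -> dotp z z <= 1) ->
  (forall i, (i < k)%N -> dotp (v i) (v i) <= 1) -> short (all_probes k v).
Proof.
move=> b1 Z1; elim: k v => // k IH v v1.
rewrite /all_probes -/all_probes.
apply: short_cat; first by apply: short_probes => z /[!inE] /eqP ->; exact: v1.
apply: short_shrink => //; first exact: v1.
by apply: short_cat; [exact: short_probes|apply: IH => i ik; exact: v1].
Qed.

End walk.

(** * Measurability of the walk and of its events *)

Section measurability.
Context {R : realType} {n : nat} (b : R) (Z : seq (n.-tuple R)).
Context {d : measure_display} {X : measurableType d}.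
Implicit Types (w f g : X -> n.-tuple R) (u : nat -> X -> R)
  (v : nat -> X -> n.-tuple R).

Lemma measurable_dotp f g : measurable_fun setT f -> measurable_fun setT g ->
  measurable_fun setT (fun x => dotp (f x) (g x)).
Proof.
move=> /measurable_fun_tnthP mf /measurable_fun_tnthP mg.
by apply: measurable_sum => i; apply: measurable_funM; [exact: mf|exact: mg].
Qed.

Lemma measurable_axpy f (a : X -> R) g : measurable_fun setT f ->
  measurable_fun setT a -> measurable_fun setT g ->
  measurable_fun setT (fun x => axpy (f x) (a x) (g x)).
Proof.
move=> /measurable_fun_tnthP mf ma /measurable_fun_tnthP mg.
apply/measurable_fun_tnthP => i.
rewrite [X in measurable_fun _ X](_ : _ =
    fun x => tnth (f x) i + a x * tnth (g x) i); last first.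
  by apply/funext => x /=; rewrite tnth_mktuple.
by apply: measurable_funD; [exact: mf|apply: measurable_funM => //; exact: mg].
Qed.

Lemma measurable_plus w (x : X -> R) g : measurable_fun setT w ->
  measurable_fun setT x -> measurable_fun setT g ->
  measurable_fun setT (fun y => plus b (w y) (x y) (g y)).
Proof.
move=> mw mx mg; apply: measurable_fun_ler => //.
apply: measurable_funB => //; apply: measurable_funM => //.
exact: measurable_dotp.
Qed.

Lemma measurable_move w (x : X -> R) g : measurable_fun setT w ->
  measurable_fun setT x -> measurable_fun setT g ->
  measurable_fun setT (fun y => move b (w y) (x y) (g y)).
Proof.
move=> mw mx mg; apply: measurable_axpy => //.
by apply: measurable_fun_ifT => //; exact: measurable_plus.
Qed.

Lemma measurable_walk k w u v : measurable_fun setT w ->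
  (forall i, measurable_fun setT (u i)) ->
  (forall i, measurable_fun setT (v i)) ->
  measurable_fun setT (fun x => walk b k (w x) (u ^~ x) (v ^~ x)).
Proof.
elim: k w u v => //= k IH w u v mw mu mv.
apply: (IH (fun x => move b (w x) (u 0%N x) (v 0%N x))
  (fun i => u i.+1) (fun i => v i.+1)) => //.
exact: measurable_move.
Qed.

Lemma measurable_normr_dotp_le f g :
  measurable_fun setT f -> measurable_fun setT g ->
  measurable_fun setT (fun x => `|dotp (f x) (g x)| <= b).
Proof.
move=> mf mg; apply: measurable_fun_ler => //.
by apply: measurableT_comp => //; exact: measurable_dotp.
Qed.

Lemma measurable_all_normr_dotp_le f (s : seq (n.-tuple R)) :
  measurable_fun setT f ->
  measurable_fun setT (fun x => all (fun z => `|dotp (f x) z| <= b) s).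
Proof.
move=> mf; elim: s => //= z s IH; apply: measurable_and => //.
exact: measurable_normr_dotp_le.
Qed.

Lemma measurable_good k w u v : measurable_fun setT w ->
  (forall i, measurable_fun setT (u i)) ->
  (forall i, measurable_fun setT (v i)) ->
  measurable_fun setT (fun x => good b Z k (w x) (u ^~ x) (v ^~ x)).
Proof.
elim: k w u v => //= k IH w u v mw mu mv.
have mm : measurable_fun setT (fun x => move b (w x) (u 0%N x) (v 0%N x)).
  exact: measurable_move.
apply: measurable_and; first exact: measurable_normr_dotp_le.
apply: measurable_and; first exact: measurable_all_normr_dotp_le.
exact: (IH (fun x => move b (w x) (u 0%N x) (v 0%N x))
  (fun i => u i.+1) (fun i => v i.+1)).
Qed.

Lemma measurable_bool_set (P : X -> bool) : measurable_fun setT P ->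
  measurable [set x | P x].
Proof.
move=> mP; rewrite (_ : [set x | P x] = setT `&` P @^-1` [set true]).
  exact: mP.
by rewrite setTI.
Qed.

End measurability.

Lemma measurable_nth_tuple {d : measure_display} {X : measurableType d}
    (k : nat) (x0 : X) (i : nat) :
  measurable_fun setT (fun v : k.-tuple X => nth x0 v i).
Proof.
have [ik|ki] := ltnP i k; last first.
  rewrite (_ : (fun _ => _) = cst x0); first exact: measurable_cst.
  by apply/funext => v; rewrite nth_default// size_tuple.
rewrite (_ : (fun _ => _) = (fun v => tnth v (Ordinal ik))).
  exact: measurable_tnth.
by apply/funext => v; rewrite (tnth_nth x0).
Qed.

(** * Uniform seeds and estimates for product measures *)

Definition uniform01 (R : realType) : probability (measurableTypeR R) R :=
  uniform_prob (@ltr01 R).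

Lemma uniform01_le (R : realType) (q : R) : 0 <= q <= 1 ->
  uniform01 R [set x | x <= q] = q%:E.
Proof.
move=> /andP[q0 q1]; rewrite /uniform01/= /uniform_prob integral_uniform_pdf.
have -> : [set x | x <= q] `&` `[0, 1] = `[0, q]%classic.
  apply/seteqP; split => x /=; rewrite !in_itv/=; first by case=> -> /andP[->].
  by move=> /andP[-> xq]; split => //; exact: le_trans q1.
rewrite (eq_integral (cst 1%E)); last first.
  move=> x; rewrite inE/= in_itv/= /uniform_pdf => /andP[-> xq].
  by rewrite (le_trans xq q1) subr0 invr1.
rewrite integral_cst// mul1e/= lebesgue_measure_itv/= lte_fin.
by case: ltgtP q0 => // [|<- _]; rewrite ?sube0.
Qed.

Section product_bounds.
Local Open Scope ereal_scope.
Context {d1 d2 : measure_display} {X : measurableType d1} {Y : measurableType d2}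
  {R : realType} (P : probability X R) (Q : probability Y R).

Lemma product_measure_fibers (E : set (X * Y)) (e : R) : measurable E ->
  (forall y, P (ysection E y) <= e%:E) -> (P \x Q) E <= e%:E.
Proof.
move=> mE h.
(* Uniqueness of the product measure allows integrating the measures of y-sections, so that y (later
   the arrivals) can be held fixed. *)
have -> : (P \x Q) E = (P \x^ Q) E.
  by apply: product_measure_unique => // A B mA mB /=; rewrite product_measure2E.
apply: (@le_trans _ _ (\int[Q]_y cst e%:E y)).
  by apply: ge0_le_integral => //=; exact: measurable_fun_ysection.
by rewrite integral_cst//= probability_setT mule1.
Qed.

(** Used with A the event that the first seed chooses +1, and B1, B2 the failure events of the
    remaining seeds after each choice. *)
Lemma product_measure_two_branches (A : set X) (B1 B2 : set Y) (q e1 e2 : R) :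
  measurable A -> measurable B1 -> measurable B2 ->
  P A = q%:E -> Q B1 <= e1%:E -> Q B2 <= e2%:E ->
  (P \x Q) (A `*` B1 `|` (~` A) `*` B2) <= (q * e1 + (1 - q) * e2)%:E.
Proof.
move=> mA m1 m2 PA Q1 Q2.
have mA' : measurable (~` A) by exact: measurableC.
apply: le_trans (@measureU2 _ _ _ (P \x Q) _ _
  (measurableX mA m1) (measurableX mA' m2)) _.
rewrite /=.
rewrite !product_measure1E// EFinD !EFinM EFinB -PA -probability_setC//.
by apply: leeD; apply: lee_wpmul2l.
Qed.

End product_bounds.

(** * Failure probability for a fixed sequence of arrivals *)

Section failure.
Context {R : realType} {n : nat} (b : R) (Z : seq (n.-tuple R)).

Definition fail_set (k : nat) (w : n.-tuple R) (v : nat -> n.-tuple R) :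
    set (k.-tuple (measurableTypeR R)) :=
  [set us | ~~ good b Z k w (nth 0 us) v].

Lemma measurable_fail_set k w v : measurable (fail_set k w v).
Proof.
apply: (measurable_bool_set
  (fun us : k.-tuple (measurableTypeR R) => ~~ good b Z k w (nth 0 us) v)).
apply: measurable_neg.
apply: (measurable_good b Z k (cst w)
  (fun i (us : k.-tuple (measurableTypeR R)) => nth 0 us i) (fun i => cst (v i))).
- exact: measurable_cst.
- by move=> i; exact: measurable_nth_tuple.
- by move=> i; exact: measurable_cst.
Qed.

(* Conditioning on the first seed splits the failure set into the two branches of
   the first sign, and [pot_step] averages the two potentials. *)
Lemma fail_set_le k w v : 1 <= b -> (forall z, z \in Z -> dotp z z <= 1) ->
  (forall i, (i < k)%N -> dotp (v i) (v i) <= 1) ->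
  (iid_law (uniform01 R) k (fail_set k w v) <= (pot b (all_probes b Z k v) w)%:E)%E.
Proof.
move=> b1 Z1; have b0 : 0 < b by lra.
elim: k w v => [|k IH] w v v1.
  rewrite (_ : fail_set 0 w v = set0) ?measure0 ?lee_fin ?pot_ge0//.
  by apply/seteqP; split.
set U := probes Z ++ all_probes b Z k (v \o succn).
rewrite -[all_probes _ _ _ _]/(probes [:: v 0%N] ++
  [seq shrink b (v 0%N) y | y <- U]) pot_cat.
(* If the first arrival already violates its bound, the trivial bound 1 suffices: the probes of
   [v 0] have potential at least 1. *)
have [wv|/negP wv] := boolP (`|dotp w (v 0%N)| <= b); last first.
  apply: le_trans (probability_le1 _ (measurable_fail_set _ _ _)) _.
  rewrite lee_fin ler_wpDr ?pot_ge0//; apply: pot_probes_ge1 => //=.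
    by move=> z /[!inE] /eqP ->; exact: v1.
  by rewrite andbT; exact/negP.
set q := plus_prob b w (v 0%N).
pose B w' : set (k.-tuple (measurableTypeR R)) :=
  [set us | ~~ (all (fun z => `|dotp w' z| <= b) Z &&
                good b Z k w' (nth 0 us) (v \o succn))].
have mB w' : measurable (B w').
  rewrite /B; case: all => /=; first exact: measurable_fail_set.
  by rewrite [X in measurable X](_ : _ = setT)//; apply/seteqP; split.
(* Either a test at w' fails and the probes of Z have potential at least 1, or the induction
   hypothesis covers the remaining steps. *)
have BU w' : (iid_law (uniform01 R) k (B w') <= (pot b U w')%:E)%E.
  rewrite pot_cat /B; case: (boolP (all _ Z)) => [_|hZ]/=.
    apply: le_trans (IH w' (v \o succn) _) _; first by move=> i; exact: (v1 i.+1).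
    by rewrite lee_fin ler_wpDl ?pot_ge0.
  apply: le_trans (probability_le1 _ _) _.
    by rewrite [X in measurable X](_ : _ = setT)//; apply/seteqP; split.
  by rewrite lee_fin ler_wpDr ?pot_ge0// pot_probes_ge1.
have sU : short U.
  apply: short_cat; first exact: short_probes.
  by apply: short_all_probes => // i; exact: (v1 i.+1).
apply: le_trans (_ : _ <= (q * pot b U (axpy w 1 (v 0%N)) +
    (1 - q) * pot b U (axpy w (-1) (v 0%N)))%:E)%E _; last first.
  by rewrite lee_fin ler_wpDl ?pot_ge0// pot_step// v1.
rewrite /= /distribution /pushforward.
rewrite [X in product_measure1 _ _ X](_ : _ =
  [set x | x <= q] `*` B (axpy w 1 (v 0%N)) `|`
  (~` [set x | x <= q]) `*` B (axpy w (-1) (v 0%N))); last first.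
  apply/seteqP; split => -[x us]; rewrite /fail_set /B /= wv/= /move /plus -/q.
    by case: (boolP (x <= q)) => xq; [left|right]; split => //=; exact/negP.
  by move=> [[/= ->]|[/= /negP/negbTE ->]].
apply: product_measure_two_branches => //.
  apply: (@measurable_bool_set _ (measurableTypeR R) (fun x => x <= q)).
  exact: measurable_fun_ler.
by apply: uniform01_le; exact: plus_prob_itv.
Qed.

End failure.

(** * The walk as an online algorithm on random arrivals *)

Section self_balancing.
Context {R : realType} {n : nat} (b : R) (T : nat).

Local Notation seeds := (T.-tuple (measurableTypeR R)).

(** The list ends with the vector to be signed, so the walk is replayed over the [(size vs).-1]
    earlier ones, with one uniform number per arrival. *)
Definition balancing_sign (us : seeds)
    (vs : seq (n.-tuple R)) : bool :=
  plus b (walk b (size vs).-1 zerov (nth 0 us) (nth zerov vs))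
    (nth 0 us (size vs).-1) (nth zerov vs (size vs).-1).

Lemma measurable_balancing_sign (k : nat) : measurable_fun setT
  (fun x : seeds * k.-tuple (n.-tuple R) =>
    balancing_sign x.1 x.2).
Proof.
rewrite (_ : (fun _ => _) = (fun x : seeds * k.-tuple (n.-tuple R) =>
    plus b (walk b k.-1 zerov (nth 0 x.1) (nth zerov x.2))
      (nth 0 x.1 k.-1) (nth zerov x.2 k.-1))); last first.
  by apply/funext => x; rewrite /balancing_sign size_tuple.
have m1 i : measurable_fun setT (fun x : seeds *
    k.-tuple (n.-tuple R) => nth 0 x.1 i).
  by apply: (measurableT_comp (measurable_nth_tuple T (0 : measurableTypeR R) i)).
have m2 i : measurable_fun setT (fun x : seeds *
    k.-tuple (n.-tuple R) => nth zerov x.2 i).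
  by apply: (measurableT_comp (measurable_nth_tuple k zerov i)).
apply: measurable_plus => //.
exact: (measurable_walk b k.-1 (cst zerov)
  (fun i (x : seeds * k.-tuple (n.-tuple R)) => nth 0 x.1 i)
  (fun i x => nth zerov x.2 i)).
Qed.

Definition self_balancing : online_algorithm R n :=
  @OnlineAlgorithm R n _ seeds
    (iid_law (uniform01 R) T) balancing_sign measurable_balancing_sign.

Lemma discrepancy_walk (us : seeds)
    (v : T.-tuple (n.-tuple R)) (t : 'I_T) :
  discrepancy (A := self_balancing) us v t =
  walk b t.+1 zerov (nth 0 us) (nth zerov v).
Proof.
apply: eq_from_tnth => i; rewrite tnth_mktuple tnth_walk tnth_mktuple add0r.
pose F j := (if plus b (walk b j zerov (nth 0 us) (nth zerov v)) (nth 0 us j)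
  (nth zerov v j) then 1 else -1) * tnth (nth zerov v j) i.
rewrite (big_ord_widen T F (ltn_ord t)).
apply: eq_bigr => j jt; rewrite /F (tnth_nth zerov) /sign_at /= /balancing_sign.
have -> : size (take j.+1 v) = j.+1 by rewrite size_takel// size_tuple.
(* The walk at time j reads only entries before j, on which v and its prefix agree. *)
by rewrite /= nth_take// (@eq_walk _ _ _ _ _ _ (nth 0 us) _ (nth zerov v))// => k kj;
  rewrite nth_take// ltnS ltnW.
Qed.

Lemma measurable_max_disc (Z : seq (n.-tuple R)) (K : R) : 0 <= K ->
  measurable [set x : seeds * T.-tuple (n.-tuple R) |
    forall t : 'I_T, \big[Num.max/0]_(z <- Z)
      `|dotp (discrepancy (A := self_balancing) x.1 x.2 t) z| <= K].
Proof.
move=> K0.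
rewrite [X in measurable X](_ : _ = \bigcap_(t in [set: 'I_T])
  [set x : seeds * T.-tuple (n.-tuple R) |
    all (fun z => `|dotp (walk b t.+1 zerov (nth 0 x.1) (nth zerov x.2)) z|
    <= K) Z]); last first.
  apply/seteqP; split => x h t.
    move=> _; apply/allP => z zZ; rewrite -discrepancy_walk.
    by apply: le_trans (h t); exact: (le_bigmax_seq 0 z xpredT
      (fun y => `|dotp (discrepancy (A := self_balancing) x.1 x.2 t) y|)).
  (* The default value 0 of the maximum is covered by K >= 0. *)
  rewrite big_seq; apply: bigmax_le => // z zZ.
  by rewrite discrepancy_walk; have /allP := h t I; apply.
apply: fin_bigcap_measurable => // t _.
apply: (measurable_bool_set (fun x : seeds *
  T.-tuple (n.-tuple R) => all (fun z =>
  `|dotp (walk b t.+1 zerov (nth 0 x.1) (nth zerov x.2)) z| <= K) Z)).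
apply: measurable_all_normr_dotp_le.
apply: (measurable_walk b t.+1 (cst zerov)
  (fun i (x : seeds * T.-tuple (n.-tuple R)) => nth 0 x.1 i)
  (fun i x => nth zerov x.2 i)) => // i.
  by apply: (measurableT_comp (measurable_nth_tuple T (0 : measurableTypeR R) i)).
by apply: (measurableT_comp (measurable_nth_tuple T zerov i)).
Qed.

Lemma self_balancing_disc (Z : seq (n.-tuple R)) (K : R)
    (p : probability (n.-tuple R) R) : 1 <= b -> b <= K ->
  (forall z, z \in Z -> enorm z <= 1) -> p [set v | enorm v <= 1] = 1%E ->
  ((1 - (2 * (T * (1 + size Z)))%N%:R * expR (- (b / 8)))%:E <=
   run_law p T self_balancing
     [set x | forall t : 'I_T,
        (\big[Num.max/0]_(z <- Z) `|dotp (discrepancy x.1 x.2 t) z| <= K)%R])%E.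
Proof.
move=> b1 bK Z1 p1; set e : R := _ * expR _.
have K0 : 0 <= K by lra.
have {}Z1 z : z \in Z -> dotp z z <= 1 by rewrite -enorm_le1; exact: Z1.
set Ev := (X in run_law _ _ _ X).
have mEv : measurable Ev by exact: measurable_max_disc.
pose N : set (T.-tuple (n.-tuple R)) :=
  [set v | forall i, enorm (tnth v i) <= 1].
have mB : measurable [set v : n.-tuple R | enorm v <= 1].
  under eq_set do rewrite enorm_le1.
  apply: (measurable_bool_set (fun v : n.-tuple R => dotp v v <= 1)).
  by apply: measurable_fun_ler => //; exact: measurable_dotp.
have mN : measurable N.
  rewrite [X in measurable X](_ : _ = \bigcap_(i in [set: 'I_T])
    ((fun v : T.-tuple (n.-tuple R) => tnth v i) @^-1` [set v | enorm v <= 1])).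
    apply: fin_bigcap_measurable => // i _.
    by rewrite -[X in measurable X]setTI; exact: measurable_tnth.
  by apply/seteqP; split => v h i; [move=> _; exact: (h i)|exact: (h i I)].
(* Almost surely all arrivals lie in the unit ball, so the failure event can be cut down to N, where
   the bound for fixed arrivals applies. *)
have PN : iid_law p T (~` N) = 0%E.
  rewrite probability_setC//.
  rewrite (iid_law_box p (A := fun=> [set v | enorm v <= 1]))//.
  by rewrite big1 ?subee// => i _; exact: p1.
pose P := run_law p T self_balancing.
have mE : measurable (~` Ev) by exact: measurableC.
have mTN : measurable ([set: seed self_balancing] `*` (~` N)).
  by apply: measurableX => //; exact: measurableC.
have mTN' : measurable ([set: seed self_balancing] `*` N) by exact: measurableX.
have PE : (P (~` Ev `&` [set: seed self_balancing] `*` N) <= e%:E)%E.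
  apply: product_measure_fibers; first exact: measurableI.
  move=> v; have [Nv|Nv] := pselect (N v); last first.
    rewrite (_ : ysection _ _ = set0) ?measure0; last first.
      by apply/seteqP; split => // us; rewrite /ysection/= inE/= => -[_ [_ /Nv]].
    by rewrite lee_fin mulr_ge0// ?expR_ge0 ?ler0n.
  have v1 i : (i < T)%N -> dotp (nth zerov v i) (nth zerov v i) <= 1.
    by move=> iT; rewrite -enorm_le1; have := Nv (Ordinal iT); rewrite (tnth_nth zerov).
  apply: (@le_trans _ _ (iid_law (uniform01 R) T
      (fail_set b Z T zerov (nth zerov v)))).
    apply: le_measure; rewrite ?inE.
    - by apply: measurable_ysection; exact: measurableI.
    - exact: measurable_fail_set.
    move=> us; rewrite /ysection/= inE/= => -[h _]; apply: contra_notN h => g t.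
    rewrite big_seq; apply: bigmax_le => // z zZ; apply: le_trans bK.
    by rewrite discrepancy_walk; exact: good_walk g _ _ (ltn_ord t) zZ.
  apply: le_trans (fail_set_le _ _ _ _ _ b1 Z1 v1) _.
  (* At the zero vector each probe weighs at most exp(-b/8), and the number of probes is the first
     factor of e. *)
  rewrite lee_fin /e -(size_all_probes b Z T (nth zerov v)).
  by apply: pot0_le; lra.
have PE' : (P (~` Ev) <= e%:E)%E.
  have h : ~` Ev `<=` (~` Ev `&` [set: seed self_balancing] `*` N) `|`
      [set: seed self_balancing] `*` (~` N).
    move=> x xE; have [?|?] := pselect (N x.2); [by left|by right].
  apply: le_trans (le_measure P _ _ h) _; rewrite ?inE//.
    by apply: measurableU => //; exact: measurableI.
  apply: le_trans (measureU2 P _ mTN) _; first exact: measurableI.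
  have PTN : (P ([set: seed self_balancing] `*` (~` N)) <= 0)%E.
    rewrite /P/= product_measure1E//; last exact: measurableC.
    by rewrite [X in (_ * X)%E](_ : _ = 0%E) ?mule0//; exact: PN.
  by rewrite -[leRHS]adde0; exact: leeD PE PTN.
have -> : Ev = ~` ~` Ev by rewrite setCK.
rewrite -/P probability_setC// EFinB; exact: leeB.
Qed.

End self_balancing.

(** * Comparison of the threshold with the rate *)

Lemma natr1D_le_expR_ln (R : realType) (s : nat) :
  (1 + s)%N%:R <= 2 * expR (ln s%:R) :> R.
Proof.
(* For s = 0 the convention ln 0 = 0 makes the right side 2; for s >= 1, 1 + s <= 2s. *)
case: s => [|s]; first by rewrite ln0// expR0 mulr1 ler_nat.
by rewrite lnK ?posrE ?ltr0n// -natrM ler_nat; lia.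
Qed.

Lemma ln_nat_ge_ln2 (R : realType) (m : nat) : 0 < ln m%:R :> R ->
  ln 2 <= ln m%:R :> R.
Proof.
case: m => [|[|m]]; [by rewrite (@ln0 _ 0%:R) ?ltxx|by rewrite ln1 ltxx|move=> _].
by rewrite ler_ln ?posrE ?ltr0n// ler_nat.
Qed.

Lemma ln_nat_ge0 (R : realType) (m : nat) : 0 <= ln m%:R :> R.
Proof. by case: m => [|m]; [rewrite ln0|rewrite ln_ge0// ler1n]. Qed.

(** Since r and L are at least k, the product r L^3 is at least k^4, k^3 r and k^3 L, so each of the
    three summands is absorbed separately. *)
Lemma threshold_le (R : realType) (k c r L : R) :
  0 < k -> 0 < c -> k <= r -> k <= L ->
  8 * (2 + r + c * L) <= 8 * (2 / k ^+ 4 + 1 / k ^+ 3 + c / k ^+ 3) * (r * L ^+ 3).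
Proof.
move=> k0 c0 kr kL; have r0 : 0 < r by lra.
have L0 : 0 < L by lra.
have k3 : 0 < k ^+ 3 by rewrite exprn_gt0.
have k4 : 0 < k ^+ 4 by rewrite exprn_gt0.
have L3 : k ^+ 3 <= L ^+ 3 by apply: lerXn2r; rewrite ?nnegrE ?(ltW k0) ?(ltW L0).
have L2 : k ^+ 2 <= L ^+ 2 by apply: lerXn2r; rewrite ?nnegrE ?(ltW k0) ?(ltW L0).
have h1 : 1 <= (r * L ^+ 3) / k ^+ 4.
  by rewrite ler_pdivlMr// mul1r exprS ler_pM// ltW.
have h2 : r <= (r * L ^+ 3) / k ^+ 3.
  by rewrite ler_pdivlMr// ler_wpM2l// ltW.
have h3 : L <= (r * L ^+ 3) / k ^+ 3.
  have -> : r * L ^+ 3 = L * (r * L ^+ 2) by ring.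
  rewrite ler_pdivlMr//; apply: ler_wpM2l; rewrite ?(ltW L0)// exprS.
  by rewrite ler_pM ?(ltW k0) ?exprn_ge0 ?(ltW k0).
move: h1 h2 (ler_wpM2l (ltW c0) h3); set Q := r * L ^+ 3 => h1 h2 h4.
have -> : 8 * (2 / k ^+ 4 + 1 / k ^+ 3 + c / k ^+ 3) * Q =
  8 * (2 * (Q / k ^+ 4) + Q / k ^+ 3 + c * (Q / k ^+ 3)) by ring.
lra.
Qed.

Theorem theorem1p3 (R : realType) (c : R) (c_gt0 : 0 < c) :
  exists C : R,
  forall (n T : nat) (S : {fset n.-tuple R}) (p : probability (n.-tuple R) R),
  0 < disc_rate R n T #|` S| ->
  (forall z, z \in S -> enorm z <= 1) ->
  p [set v | enorm v <= 1] = 1%E ->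
  exists A : online_algorithm R n,
  ((1 - (n * T)%N%:R `^ (- c))%:E <=
   run_law p T A
     [set x | forall t : 'I_T,
        (\big[Num.max/0]_(z <- S) `|dotp (discrepancy x.1 x.2 t) z|
          <= C * disc_rate R n T #|` S|)%R])%E.
Proof.
set k : R := ln 2; have k0 : 0 < k by rewrite ln_gt0// ltr1n.
(* The constant is that of [threshold_le]; ln 2 is the smallest positive logarithm of a natural
   number. *)
exists (8 * (2 / k ^+ 4 + 1 / k ^+ 3 + c / k ^+ 3)) => n T S p.
rewrite /disc_rate; set r := ln _ + ln _; set L := ln _ => rate0 S1 p1.
have r_ge0 : 0 <= r by rewrite addr_ge0 ?ln_nat_ge0.
have L0 : 0 < L.
  rewrite lt_neqAle ln_nat_ge0 andbT eq_sym; apply: contraTneq rate0 => ->.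
  by rewrite expr0n mulr0 ltxx.
have r0 : 0 < r.
  rewrite lt_neqAle r_ge0 andbT eq_sym; apply: contraTneq rate0 => ->.
  by rewrite mul0r ltxx.
have nT0 : (0 < n * T)%N.
  by rewrite lt0n; apply: contraTneq L0; rewrite /L => ->; rewrite ln0 ?ltxx.
have T0 : (0 < T)%N by case: T nT0 {r L rate0 r_ge0 L0 r0} => //; rewrite muln0.
(* One of ln |S| and ln T is positive, hence at least ln 2, and the other is nonnegative. *)
have kr : k <= r.
  have [sT|sT] := ltP 0 (ln #|` S|%:R : R).
    by rewrite /r ler_wpDr ?ln_nat_ge0// ln_nat_ge_ln2.
  rewrite /r ler_wpDl ?ln_nat_ge0// ln_nat_ge_ln2//; move: r0; rewrite /r; lra.
(* This makes exp(-b/8) equal to e^(-2) |S|^(-1) T^(-1) (nT)^(-c), with |S|^(-1) read as 1 for empty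
   S. *)
pose b := 8 * (2 + r + c * L).
have cL : 0 < c * L by rewrite mulr_gt0.
exists (self_balancing b T).
apply: le_trans (self_balancing_disc b T S _ p _ _ S1 p1); last 2 first.
- by rewrite /b; lra.
- by apply: threshold_le => //; exact: ln_nat_ge_ln2.
rewrite lee_fin lerD2l lerN2.
have -> : (n * T)%N%:R `^ (- c) = expR (- (c * L)) :> R.
  by rewrite /powR pnatr_eq0 eqn0Ngt nT0/= mulNr.
have -> : - (b / 8) = - 2 - ln #|` S|%:R - ln T%:R + - (c * L).
  by rewrite /b /r; field.
rewrite expRD mulrA ler_piMl ?expR_ge0// !expRD !natrM.
rewrite !expRN (lnK (x := T%:R)) ?posrE ?ltr0n//.
(* The factor e^2 absorbs 4: a 2 for the two signs of a probe and a 2 from 1 + |S| <= 2 exp(ln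
   |S|). *)
have e2 : 4 <= expR 2 :> R.
  have e1 : 2 <= expR 1 :> R by have := expR_ge1Dx (1 : R); lra.
  have -> : 2 = 1 + 1 :> R by lra.
  rewrite expRD; nra.
have hs := natr1D_le_expR_ln R #|` S|.
have T0' : T%:R != 0 :> R by rewrite pnatr_eq0 -lt0n.
set E := expR (ln _) in hs *; have E0 : 0 < E by exact: expR_gt0.
have -> : 2 * (T%:R * (1 + size S)%N%:R) * (((expR 2)^-1 * E^-1) / T%:R) =
   (2 * (1 + size S)%N%:R) / (expR 2 * E) :> R.
  by field; rewrite T0' !gt_eqF ?expR_gt0.
rewrite ler_pdivrMr ?mulr_gt0 ?expR_gt0// mul1r.
move: hs; rewrite cardfE; nra.
Qed.
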